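(* The base-$x$ digit ordering $<$ on $\mathbb{Z}[x]$ makes $\mathbb{Z}[x]$ an ordered integral domain. In particular, for $f,g\in\mathbb{Z}[x]$, $f>g$ if and only if $f-g$ has positive leading coefficient. If $f>g$, then (i) $f+h>g+h$ for all $h\in\mathbb{Z}[x]$, and (ii) $fh>gh$ for all $h\in\mathbb{Z}[x]$ with $h>0$.
   Context: A polynomial in $\mathbb{Z}[x]$ is called positive if its leading coefficient is positive. The polynomial alphabet is the set of digits $\{0,1,2,\dots\}\cup\{x-1,x-2,\dots\}$, linearly ordered by $0<1<\cdots<n<\cdots<x-n<\cdots<x-2<x-1$. Every positive $f\in\mathbb{Z}[x]$ has a unique base-$x$ representation $f(x)=\sum_{i=0}^m b_i(x)x^i$ with all $b_i(x)$ in the alphabet and $b_m(x)\neq0$; it has $m+1$ digits. The base-$x$ digit ordering on $\mathbb{Z}[x]$ is defined as follows: positive polynomials are compared first by number of digits (more digits is larger), and, when these are equal, lexicographically by digits starting from the leading digit $b_m(x)$; $0$ is smaller than every positive polynomial; every $f$ with $-f$ positive is smaller than $0$ and than every positive polynomial; and if $-f,-g$ are positive then $f<g$ iff $-g<-f$. *)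

(* Defs.v *)
From mathcomp Require Import all_boot all_order all_algebra.
Set Implicit Arguments.
Unset Strict Implicit.
Unset Printing Implicit Defensive.
Import Order.TTheory GRing.Theory Num.Theory.
Local Open Scope ring_scope.

Definition positive (f : {poly int}) : Prop := 0 < lead_coef f.

(* Low n is the digit n; High k is the digit x - (k + 1), so that the digits  *)
(* x - 1, x - 2, ... are High 0, High 1, ... without repetition.              *)
Inductive digit : Type := Low of nat | High of nat.

Definition digit_poly (d : digit) : {poly int} :=
  match d with
  | Low n => n%:Z%:P
  | High k => 'X - k.+1%:Z%:P
  end.

Definition digit_lt (d e : digit) : bool :=
  match d, e with
  | Low m, Low n => (m < n)%N
  | Low _, High _ => true
  | High _, Low _ => false
  | High j, High k => (k < j)%N
  end.

(* Digit sequences are stored least significant digit first, so the leading   *)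
(* digit is the last one. The default value Low 0 of [last] excludes [::].    *)
Definition base_x_repr (f : {poly int}) (b : seq digit) : Prop :=
  digit_poly (last (Low 0) b) <> 0 /\
  f = \sum_(i < size b) digit_poly (nth (Low 0) b i) * 'X^i.

(* Lexicographic comparison from the leading digit down; only meant for       *)
(* sequences b and c of the same size.                                        *)
Definition lex_lt (b c : seq digit) : Prop :=
  exists2 i : nat, (i < size b)%N &
    digit_lt (nth (Low 0) b i) (nth (Low 0) c i) /\
    forall j : nat, (i < j < size b)%N -> nth (Low 0) b j = nth (Low 0) c j.

Definition digits_lt (b c : seq digit) : Prop :=
  (size b < size c)%N \/ size b = size c /\ lex_lt b c.

Definition pos_lt (f g : {poly int}) : Prop :=
  exists b c : seq digit,
    [/\ base_x_repr f b, base_x_repr g c & digits_lt b c].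

Inductive base_x_lt (f g : {poly int}) : Prop :=
| LtPosPos of positive f & positive g & pos_lt f g
| LtZeroPos of f = 0 & positive g
| LtNegZero of positive (- f) & g = 0
| LtNegPos of positive (- f) & positive g
| LtNegNeg of positive (- f) & positive (- g) & pos_lt (- g) (- f).

(* A strict linear order compatible with the ring operations. Unlike          *)
(* realDomainType, this is a property of a given Prop-valued relation.        *)
Record ordered_integral_domain (R : idomainType) (lt : R -> R -> Prop) : Prop :=
  OrderedIntegralDomain {
    oid_irrefl : forall a, ~ lt a a;
    oid_trans : forall a b c, lt a b -> lt b c -> lt a c;
    oid_total : forall a b, [\/ lt a b, a = b | lt b a];
    oid_add : forall a b c, lt a b -> lt (a + c) (b + c);
    oid_mul : forall a b, lt 0 a -> lt 0 b -> lt 0 (a * b)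
  }.

(* Main.v *)
(* Every positive polynomial has a base-x representation, so on positive       *)
(* polynomials the digit ordering is total; f < g iff g - f is positive then   *)
(* follows once the direct implication is known. For the latter, strip the     *)
(* least significant digits: f = d + x p and g = e + x q. If p = q, compare    *)
(* d and e. If p < q, then q - p - 1 >= 0 because the coefficients are         *)
(* integers, and g - f = x (q - p - 1) + (x - d) + e is positive, as every     *)
(* digit lies between 0 and x.                                                 *)
Require Import Defs.
From mathcomp Require Import all_boot all_order all_algebra.
From mathcomp Require Import ring.
Set Implicit Arguments.
Unset Strict Implicit.
Unset Printing Implicit Defensive.
Import Order.TTheory GRing.Theory Num.Theory.
Local Open Scope ring_scope.

(** Everything rests on [base_x_ltP]: the digit ordering is the one whose positive cone is the set
    of polynomials with positive leading coefficient. This cone is closed under sums ([positiveD])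
    and products ([positiveM]) and satisfies trichotomy, so the axioms of an ordered domain follow.
    Between positive polynomials, [digits_lt_positive] turns a digit comparison into a positive
    difference; the converse, in [pos_ltP], combines existence of representations
    ([base_x_repr_exists]) with totality of the comparison ([digits_lt_total]). *)

Lemma positive0 : ~ positive 0.
Proof. by rewrite /positive lead_coef0 ltxx. Qed.

Lemma positive_trichotomy (f : {poly int}) :
  [\/ positive f, f = 0 | positive (- f)].
Proof.
rewrite /positive lead_coefN oppr_gt0.
case: (ltgtP 0 (lead_coef f)) => [| |/esym/eqP]; first by constructor 1.
  by constructor 3.
by rewrite lead_coef_eq0 => /eqP; constructor 2.
Qed.

Lemma positive_nonneg (f : {poly int}) : positive f -> 0 <= lead_coef f.
Proof. exact: ltW. Qed.

(** The longer summand dictates the sign; at equal sizes the top coefficients cannot cancel, one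
    being nonnegative and the other positive. The weak hypothesis lets [f] be zero, as a digit may
    be. *)
Lemma positiveDr (f g : {poly int}) :
  0 <= lead_coef f -> positive g -> positive (f + g).
Proof.
rewrite /positive => f_ge0 g_gt0.
case: (ltngtP (size f) (size g)) => [lt_fg | lt_gf | eq_fg].
- by rewrite lead_coefDr.
- rewrite lead_coefDl // lt_neqAle f_ge0 andbT eq_sym lead_coef_eq0.
  by rewrite -size_poly_gt0 (leq_ltn_trans _ lt_gf).
have top_gt0 : 0 < (f + g)`_(size g).-1.
  by rewrite coefD -{1}eq_fg ltr_wpDl.
have size_fg : size (f + g) = size g.
  apply/eqP; rewrite eqn_leq; apply/andP; split.
    by rewrite (leq_trans (size_polyD _ _)) // eq_fg maxnn.
  have g_neq0 : (0 < size g)%N by rewrite size_poly_gt0 -lead_coef_eq0 gt_eqF.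
  rewrite -(prednK g_neq0) ltnNge; apply/negP => /leq_sizeP/(_ _ (leqnn _)).
  by move=> top0; rewrite top0 ltxx in top_gt0.
by rewrite lead_coefE size_fg.
Qed.

Lemma lead_coefD_ge0 (f g : {poly int}) :
  0 <= lead_coef f -> 0 <= lead_coef g -> 0 <= lead_coef (f + g).
Proof.
move=> f_ge0; rewrite le_eqVlt => /orP[|g_gt0]; last exact/ltW/positiveDr.
by rewrite eq_sym lead_coef_eq0 => /eqP->; rewrite addr0.
Qed.

Lemma positiveD (f g : {poly int}) :
  positive f -> positive g -> positive (f + g).
Proof. by move=> /positive_nonneg; apply: positiveDr. Qed.

Lemma positiveM (f g : {poly int}) :
  positive f -> positive g -> positive (f * g).
Proof. by rewrite /positive lead_coefM; apply: mulr_gt0. Qed.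

Lemma positive_asym (f : {poly int}) : positive f -> ~ positive (- f).
Proof. by rewrite /positive lead_coefN oppr_gt0 => /lt_trans h /h; rewrite ltxx. Qed.

(** Discreteness of the integers: a positive constant is at least 1, and subtracting 1 from a
    nonconstant polynomial keeps its leading coefficient. *)
Lemma positive_subr1_ge0 (f : {poly int}) :
  positive f -> 0 <= lead_coef (f - 1).
Proof.
rewrite /positive => f_gt0; have [f_small|f_big] := leqP (size f) 1%N.
  move: f_gt0; rewrite (size1_polyC f_small) -polyCB !lead_coefC.
  by rewrite subr_ge0 -gtz0_ge1.
by rewrite lead_coefDl ?ltW // size_polyN size_poly1.
Qed.

(** A borrow: one unit of [f] is worth ['X] in the lower position, enough to absorb a negative
    difference [g] of two digits. *)
Lemma positive_Xsubr (f g : {poly int}) :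
  positive f -> positive ('X + g) -> positive ('X * f + g).
Proof.
move=> f_gt0 g_gt0.
have -> : 'X * f + g = (f - 1) * 'X + ('X + g) by ring.
by apply: positiveDr => //; rewrite lead_coefMX positive_subr1_ge0.
Qed.

Lemma digit_poly_ge0 (d : digit) : 0 <= lead_coef (digit_poly d).
Proof. by case: d => n /=; rewrite ?lead_coefC ?lead_coefXsubC. Qed.

Lemma digit_poly_ltX (d : digit) : positive ('X - digit_poly d).
Proof.
rewrite /positive; case: d => n /=; first by rewrite lead_coefXsubC.
by rewrite opprB addrC subrK lead_coefC.
Qed.

Lemma digit_lt_positive (d e : digit) :
  digit_lt d e -> positive (digit_poly e - digit_poly d).
Proof.
rewrite /positive; case: d e => m [] n //= lt_mn.
- by rewrite -polyCB lead_coefC subr_gt0 ltz_nat.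
- by rewrite -addrA -opprD -polyCD lead_coefXsubC.
- rewrite opprB addrC addrA subrK -polyCB lead_coefC subr_gt0.
  by rewrite ltz_nat ltnS.
Qed.

Lemma digit_lt_total (d e : digit) : [\/ digit_lt d e, d = e | digit_lt e d].
Proof.
case: d e => m [] n /=; try by [constructor 1 | constructor 3].
- by case: (ltngtP m n) => [||->]; [constructor 1|constructor 3|constructor 2].
- by case: (ltngtP m n) => [||->]; [constructor 3|constructor 1|constructor 2].
Qed.

(** Since the head is the least significant digit, it only breaks ties between tails. This is what
    permits structural induction on digit sequences: index 0 in [lex_lt] is the tie-break, and a
    larger index is a difference inside the tails. *)
Lemma digits_lt_consP (d e : digit) (b c : seq digit) :
  digits_lt (d :: b) (e :: c) <-> digits_lt b c \/ b = c /\ digit_lt d e.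
Proof.
rewrite /digits_lt /= ltnS; split=> [[|[[eq_sz] [[|i] lt_i [lt_de above]]]]|].
- by left; left.
- right; split=> //; apply: (eq_from_nth (x0 := Low 0) eq_sz) => j lt_j.
  exact: (above j.+1).
- by left; right; split=> //; exists i => //; split=> // j; apply: (above j.+1).
case=> [[|[eq_sz [i lt_i [lt_bc above]]]]|[<- lt_de]]; first by left.
  right; split; first by rewrite eq_sz.
  by exists i.+1 => //; split=> // -[|j] //; apply: above.
by right; split=> //; exists 0%N => //; split=> // -[].
Qed.

Lemma digits_lt_total (b c : seq digit) :
  [\/ digits_lt b c, b = c | digits_lt c b].
Proof.
elim: b c => [|d b IH] [|e c]; try by [constructor 2].
- by constructor 1; left.
- by constructor 3; left.
case: (IH c) => [lt_bc|<-|lt_cb].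
- by constructor 1; apply/digits_lt_consP; left.
- case: (digit_lt_total d e) => [lt_de|<-|lt_ed]; last 2 first.
  + by constructor 2.
  + by constructor 3; apply/digits_lt_consP; right.
  by constructor 1; apply/digits_lt_consP; right.
- by constructor 3; apply/digits_lt_consP; left.
Qed.

(** The sum inside [base_x_repr], named so that it can be unfolded by Horner's rule in
    [digits_val_cons]. *)
Definition digits_val (b : seq digit) : {poly int} :=
  \sum_(i < size b) digit_poly (nth (Low 0) b i) * 'X^i.

Lemma digits_val_nil : digits_val [::] = 0.
Proof. by rewrite /digits_val big_ord0. Qed.

Lemma digits_val_cons (d : digit) (b : seq digit) :
  digits_val (d :: b) = 'X * digits_val b + digit_poly d.
Proof.
rewrite /digits_val /= big_ord_recl /= expr0 mulr1 addrC mulr_sumr.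
by congr (_ + _); apply: eq_bigr => i _; rewrite exprS mulrCA.
Qed.

Lemma digits_val_ge0 (b : seq digit) : 0 <= lead_coef (digits_val b).
Proof.
elim: b => [|d b IH]; first by rewrite digits_val_nil lead_coef0.
rewrite digits_val_cons lead_coefD_ge0 ?digit_poly_ge0 //.
by rewrite mulrC lead_coefMX.
Qed.

Lemma digits_val_gt0 (b : seq digit) :
  digit_poly (last (Low 0) b) <> 0 -> positive (digits_val b).
Proof.
elim: b => [|d [|e b] IH] //= last_neq0.
  rewrite digits_val_cons digits_val_nil mulr0 add0r /positive lt_neqAle.
  by rewrite digit_poly_ge0 andbT eq_sym lead_coef_eq0; apply/eqP.
rewrite digits_val_cons addrC; apply: positiveDr (digit_poly_ge0 d) _.
by rewrite /positive mulrC lead_coefMX; apply: IH.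
Qed.

Lemma digits_lt_positive (b c : seq digit) :
  digit_poly (last (Low 0) c) <> 0 -> digits_lt b c ->
  positive (digits_val c - digits_val b).
Proof.
elim: b c => [|d b IH] [|e c]; try by move=> _ [|[? []]].
  by move=> /digits_val_gt0; rewrite digits_val_nil subr0.
move=> last_neq0 /digits_lt_consP[lt_bc|[-> /digit_lt_positive lt_de]]; last first.
  by rewrite !digits_val_cons opprD addrACA subrr add0r.
(* A sequence that exceeds another is nonempty, so [c] and [e :: c] share their leading digit. *)
have c_last : digit_poly (last (Low 0) c) <> 0.
  by case: c lt_bc last_neq0 {IH} => // -[|[/size0nil-> []]].
rewrite !digits_val_cons opprD addrACA -mulrBr.
apply: positive_Xsubr; first exact: IH.
(* ['X] plus the digit difference regroups as [e + ('X - d)]. *)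
by rewrite addrCA; apply: positiveDr (digit_poly_ge0 e) (digit_poly_ltX d).
Qed.

Lemma base_x_repr_cons (d : digit) (f : {poly int}) (b : seq digit) :
  base_x_repr f b -> base_x_repr ('X * f + digit_poly d) (d :: b).
Proof.
case=> last_neq0 ->; split; last by rewrite -/(digits_val (d :: b)) digits_val_cons.
by case: b last_neq0.
Qed.

Lemma base_x_repr1 (d : digit) :
  digit_poly d <> 0 -> base_x_repr (digit_poly d) [:: d].
Proof. by split=> //; rewrite big_ord1 expr0 mulr1. Qed.

(** Induction on the size, splitting off the constant term: [f = 'X * q + c]. A nonnegative [c] is
    itself the lowest digit; a negative one is repaired by borrowing 1 from [q], which makes the
    digit ['X + c]. *)
Lemma base_x_repr_exists (f : {poly int}) :
  positive f -> exists b : seq digit, base_x_repr f b.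
Proof.
have [n] := ubnP (size f); elim: n f => // n IH f size_f f_gt0.
have [q [c f_def]] : exists q c, f = 'X * q + c%:P.
  elim/poly_ind: f {size_f f_gt0} => [|q c _]; last by exists q, c; rewrite mulrC.
  by exists 0, 0; rewrite mulr0 addr0.
have [q0|q_neq0] := eqVneq q 0.
  move: f_gt0; rewrite f_def q0 mulr0 add0r /positive lead_coefC.
  case: c {f_def} => // c c_gt0; exists [:: Low c].
  by apply: (base_x_repr1 (d := Low c)) => /= /eqP; rewrite polyC_eq0 gt_eqF.
have size_qX : size ('X * q) = (size q).+1 by rewrite mulrC size_mulX.
have lt_cq : (size c%:P < size ('X * q)%R)%N.
  rewrite size_qX ltnS (leq_trans (size_polyC_leq1 _)) //.
  by rewrite size_poly_gt0.
have size_q : (size q < n)%N.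
  by move: size_f; rewrite f_def size_polyDl // size_qX.
have q_gt0 : positive q.
  by move: f_gt0; rewrite f_def /positive lead_coefDl // mulrC lead_coefMX.
case: c f_def {lt_cq} => [k|k] f_def.
  have [b /(base_x_repr_cons (Low k))] := IH q size_q q_gt0.
  by exists (Low k :: b); rewrite f_def.
(* Here [c] is [Negz k], that is [-(k + 1)], so ['X + c] is exactly [High k]. *)
have {}f_def : f = 'X * (q - 1) + digit_poly (High k).
  by rewrite f_def /= NegzE polyCN mulrBr mulr1 addrA subrK.
(* The borrow may exhaust [q]; then [f] is the single digit [High k]. *)
have := positive_subr1_ge0 q_gt0; rewrite le_eqVlt => /orP[|q1_gt0].
  rewrite eq_sym lead_coef_eq0 => /eqP q1; exists [:: High k].
  rewrite f_def q1 mulr0 add0r; apply: base_x_repr1 => /eqP.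
  by rewrite polyXsubC_eq0.
have [|b] := IH (q - 1) _ q1_gt0.
  rewrite (leq_ltn_trans (size_polyD _ _)) // size_polyN size_poly1.
  by rewrite (maxn_idPl _) // size_poly_gt0.
by move=> /(base_x_repr_cons (High k)); exists (High k :: b); rewrite f_def.
Qed.

(** For the converse, fix representations of both sides: were their digits equal or in the opposite
    order, [g - f] would be zero or negative. *)
Lemma pos_ltP (f g : {poly int}) :
  positive f -> positive g -> pos_lt f g <-> positive (g - f).
Proof.
move=> f_gt0 g_gt0; split.
  by case=> b [c [[_ ->] [c_last ->] /digits_lt_positive]]; apply.
have [b fb] := base_x_repr_exists f_gt0.
have [c gc] := base_x_repr_exists g_gt0.
case: (digits_lt_total b c) => [lt_bc _|eq_bc|lt_cb]; first by exists b, c.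
  case: gc => _ ->; case: fb => _ ->.
  by rewrite eq_bc subrr => /positive0.
case: fb gc => b_last -> [_ ->].
by move/positive_asym; rewrite opprB => -[]; apply: digits_lt_positive.
Qed.

Lemma base_x_ltP (f g : {poly int}) : base_x_lt g f <-> positive (f - g).
Proof.
split.
  case=> [g0 f0 /(pos_ltP g0 f0)| -> f0|g0 ->|g0 f0|g0 f0 /(pos_ltP f0 g0)] //.
  - by rewrite subr0.
  - by rewrite sub0r.
  - exact: positiveD.
  - by rewrite opprK addrC.
move=> fg; case: (positive_trichotomy g) (positive_trichotomy f) => [g0|g0|g0].
- case=> [f0|f0|f0].
  + by apply: LtPosPos => //; apply/pos_ltP.
  + by move: fg; rewrite f0 sub0r => /(positive_asym g0).
  (* Three positive polynomials, [f - g], [g] and [- f], would sum to 0. *)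
  + by case: positive0; have := positiveD (positiveD fg g0) f0; rewrite subrK subrr.
- by move=> _; apply: LtZeroPos => //; rewrite g0 subr0 in fg.
- case=> f0; [exact: LtNegPos | exact: LtNegZero |].
  by apply: LtNegNeg => //; apply/pos_ltP; rewrite // opprK addrC.
Qed.

Theorem corollary1 :
  [/\ @ordered_integral_domain {poly int} base_x_lt,
      forall f g : {poly int}, base_x_lt g f <-> positive (f - g)
    & forall f g : {poly int}, base_x_lt g f ->
        (forall h : {poly int}, base_x_lt (g + h) (f + h)) /\
        (forall h : {poly int}, base_x_lt 0 h -> base_x_lt (g * h) (f * h))].
Proof.
have ltD (f g h : {poly int}) : base_x_lt g f -> base_x_lt (g + h) (f + h).
  by move/base_x_ltP=> fg; apply/base_x_ltP; rewrite opprD addrACA subrr addr0.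
split; [split | exact: base_x_ltP | move=> f g fg; split].
- by move=> f /base_x_ltP; rewrite subrr => /positive0.
- move=> f g h /base_x_ltP fg /base_x_ltP gh; apply/base_x_ltP.
  by rewrite -(subrKA g); apply: positiveD.
- move=> f g; case: (positive_trichotomy (g - f)) => [|/eqP|].
  + by move/base_x_ltP; constructor 1.
  + by rewrite subr_eq0 eq_sym => /eqP; constructor 2.
  + by rewrite opprB => /base_x_ltP; constructor 3.
- by move=> f g h; apply: ltD.
- move=> f g /base_x_ltP f0 /base_x_ltP g0; apply/base_x_ltP.
  by rewrite !subr0 in f0 g0 *; apply: positiveM.
- by move=> h; apply: ltD.
- move=> h /base_x_ltP h0; move/base_x_ltP: fg => fg; apply/base_x_ltP.
  by rewrite subr0 in h0; rewrite -mulrBl; apply: positiveM.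
Qed.
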